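(* Let $\|\cdot\|$ be a norm on $\mathbb{R}^n$, let $\Omega\subseteq\mathbb{R}^n$ be an open set and $F:\Omega\to\mathbb{R}^n$ be continuously differentiable in $\Omega$. Take $x_*\in\Omega$ and let $\kappa:=\sup\{t>0: B(x_*,t)\subset\Omega\}$. Assume that $F'(x_* )$ is invertible, $F(x_* )=0$, and there exists $K>0$ such that $$\left\|F'(x_* )^{-1}[F'(x)-F'(y)]\right\|\le K\|x-y\|,\qquad\forall\,x,y\in B(x_*,\kappa).$$ Take $0\le\vartheta<1$ and $0\le\omega_2<\omega_1$ such that $\omega_1\vartheta+\omega_2<1$. Let $$\sigma:=\min\left\{\kappa,\ \frac{2(1-\vartheta\omega_1-\omega_2)}{K(2+\omega_1-\vartheta\omega_1-2\omega_2)}\right\}.$$ Then any inexact Newton-like method for solving $F(x)=0$ with initial point $x_0\in B(x_*,\sigma)\setminus\{x_*\}$, $$x_{k+1}=x_k+S_k,\qquad B(x_k)S_k=-F(x_k)+r_k,\qquad k=0,1,\ldots,$$ where $B(x_k)$ is an invertible approximation of $F'(x_k)$ satisfying $$\|B(x_k)^{-1}F'(x_k)\|\le\omega_1,\qquad\|B(x_k)^{-1}F'(x_k)-I\|\le\omega_2,$$ and the residual $r_k$ satisfies $\|P_kr_k\|\le\theta_k\|P_kF(x_k)\|$ for some sequence $\{P_k\}$ of invertible matrices and some sequence $\{\theta_k\}$ of non-negative numbers satisfying $\theta_k\,\mathrm{cond}(P_kF'(x_k))\le\vartheta$, is well defined, its sequence $\{x_k\}$ is contained in $B(x_*,\sigma)$,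 converges to $x_*$, and $$\|x_{k+1}-x_*\|\le\left[\omega_1(1+\vartheta)\frac{K\|x_0-x_*\|}{2(1-K\|x_0-x_*\|)}+\omega_1\vartheta+\omega_2\right]\|x_k-x_*\|,\qquad\forall\,k=0,1,\ldots.$$
   Context: $B(a,\delta)=\{x\in\mathbb{R}^n:\|x-a\|<\delta\}$ ($\kappa=+\infty$ is allowed, with $B(x_*,+\infty)=\mathbb{R}^n$). Norms of linear operators on $\mathbb{R}^n$ are the operator norms induced by $\|\cdot\|$; $I$ is the identity; for an invertible operator $T$, $\mathrm{cond}(T):=\|T\|\,\|T^{-1}\|$. ''Well defined'' means that each iterate $x_k$ lies in $\Omega$ and $F'(x_k)$ is invertible, so that the conditions defining the next step make sense. *)

(* Defs.v *)
From HB Require Import structures.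
From mathcomp Require Export all_boot all_order all_algebra.
From mathcomp Require Export all_classical all_reals all_analysis.
Export numFieldNormedType.Exports.

Set Implicit Arguments.
Unset Strict Implicit.
Unset Printing Implicit Defensive.

Import Order.TTheory GRing.Theory Num.Theory.

Local Open Scope classical_set_scope.
Local Open Scope ring_scope.

(* Points of R^n are column vectors 'cV[R]_n and operators are matrices acting
   on the left.  'cV[R]_n carries the library's sup norm and its topology; the
   norm N below is arbitrary and unrelated to it.  Openness, differentiability,
   continuity and convergence do not depend on the norm in finite dimension,
   and are taken in the library's topology. *)

Record is_norm (R : realType) (n : nat) (N : 'cV[R]_n -> R) : Prop := IsNorm {
  is_norm_ge0 : forall v, 0 <= N v ;
  is_norm_eq0 : forall v, N v = 0 -> v = 0 ;
  is_normZ : forall (a : R) v, N (a *: v) = `|a| * N v ;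
  is_normD : forall u v, N (u + v) <= N u + N v }.

(* The radius is an extended real; radius +oo gives the whole space. *)
Definition nball (R : realType) (n : nat) (N : 'cV[R]_n -> R)
    (a : 'cV[R]_n) (delta : \bar R) : set 'cV[R]_n :=
  [set x | ((N (x - a))%:E < delta)%E].

Definition inner_radius (R : realType) (n : nat) (N : 'cV[R]_n -> R)
    (Omega : set 'cV[R]_n) (a : 'cV[R]_n) : \bar R :=
  ereal_sup [set t%:E | t in [set t : R | 0 < t /\ nball N a t%:E `<=` Omega]].

Definition opnorm (R : realType) (n : nat) (N : 'cV[R]_n -> R)
    (A : 'M[R]_n) : R :=
  sup [set N (A *m v) | v in [set v | N v <= 1]].

Definition cond (R : realType) (n : nat) (N : 'cV[R]_n -> R)
    (T : 'M[R]_n) : R :=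
  opnorm N T * opnorm N (invmx T).

(* The matrix of the Frechet derivative 'd F x (the library's 'J F x is the
   transposed matrix, for row vectors). *)
Definition derivmx (R : realType) (n : nat) (F : 'cV[R]_n -> 'cV[R]_n)
    (x : 'cV[R]_n) : 'M[R]_n :=
  \matrix_(i, j) ('d F x (delta_mx j 0)) i 0.

Lemma derivmxE (R : realType) (n : nat) (F : 'cV[R]_n -> 'cV[R]_n)
    (x v : 'cV[R]_n) : derivmx F x *m v = 'd F x v.
Proof.
rewrite [in RHS](matrix_sum_delta v) linear_sum; apply/colP => i.
rewrite mxE summxE; apply: eq_bigr => j _.
by rewrite big_ord1 linearZ !mxE mulrC.
Qed.

(* F is a total function constrained only on the open set Omega. *)
Definition C1_on (R : realType) (n : nat) (Omega : set 'cV[R]_n)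
    (F : 'cV[R]_n -> 'cV[R]_n) : Prop :=
  (forall x, Omega x -> differentiable F x) /\
  {within Omega, continuous (derivmx F)}.

(* The conditions defining the passage from x k to x k.+1.  They are meaningful
   when x k lies in the domain of F and derivmx F (x k) is invertible; neither
   is part of the definition, since both are to be proved. *)
Definition inexact_newton_like_step (R : realType) (n : nat)
    (N : 'cV[R]_n -> R) (F : 'cV[R]_n -> 'cV[R]_n) (B : 'cV[R]_n -> 'M[R]_n)
    (vartheta omega1 omega2 : R) (x S r : nat -> 'cV[R]_n)
    (P : nat -> 'M[R]_n) (theta : nat -> R) (k : nat) : Prop :=
  [/\ x k.+1 = x k + S k,
      B (x k) *m S k = - F (x k) + r k,
      [/\ B (x k) \in unitmx,
          opnorm N (invmx (B (x k)) *m derivmx F (x k)) <= omega1 &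
          opnorm N (invmx (B (x k)) *m derivmx F (x k) - 1%:M) <= omega2] &
      [/\ P k \in unitmx,
          0 <= theta k,
          N (P k *m r k) <= theta k * N (P k *m F (x k)) &
          theta k * cond N (P k *m derivmx F (x k)) <= vartheta]].

(* Main.v *)
(* Put e_k = N (x_k - xs) and f = F'(x_k)^-1 F(x_k).  The mean value inequality
   along the segment from x_k to xs and the Banach perturbation lemma bound the
   Newton remainder rho = f - (x_k - xs) by
   K e_k^2 / (2 (1 - K e_k)).  The new error is
     - (B^-1 F' - I) (x_k - xs) - B^-1 F' rho + B^-1 F' (F'^-1 r_k),
   and the residual test with (P F')^-1 P = F'^-1 gives
   N (F'^-1 r_k) <= vartheta N f <= vartheta (e_k + N rho).  The resulting
   factor increases with e_k and is below 1 when e_k is below the second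
   term of the minimum defining sigma, so e_k decreases geometrically. *)

Require Import Defs.
From mathcomp Require Import ring lra.

Set Implicit Arguments.
Unset Strict Implicit.
Unset Printing Implicit Defensive.

Import Order.TTheory GRing.Theory Num.Theory.

Local Open Scope classical_set_scope.
Local Open Scope ring_scope.

(** * Sup norm of matrices and left difference quotients *)

Lemma le_abs_mx_norm (R : realType) m p (M : 'M[R]_(m, p)) i j : `|M i j| <= `|M|.
Proof.
rewrite [leRHS]/Num.Def.normr/= mx_normrE.
exact: (le_bigmax _ (fun ij : 'I_m * 'I_p => `|M ij.1 ij.2|) (i, j)).
Qed.

Lemma mx_norm_tr (R : realType) m p (M : 'M[R]_(m, p)) : `|M^T| = `|M|.
Proof.
have le_tr a b (L : 'M[R]_(a, b)) : `|L^T| <= `|L|.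
  rewrite [leLHS]/Num.Def.normr/= mx_normrE bigmax_le// => -[i j] _.
  by rewrite mxE le_abs_mx_norm.
by apply/eqP; rewrite eq_le le_tr -{1}[M]trmxK le_tr.
Qed.

Lemma is_derive_cvg_at_left (R : realType) (V : normedModType R) (f : R -> V)
    (c : R) (df : V) :
  is_derive c 1 f df -> s^-1 *: (f (s + c) - f c) @[s --> 0^'-] --> df.
Proof.
move=> [fD <-]; apply: cvg_dnbhs_at_left => /=.
have -> : (fun s => s^-1 *: (f (s + c) - f c)) =
    (fun s => s^-1 *: ((f \o shift c) (s *: (1 : R)) - f c)).
  by apply/funext => s /=; rewrite [s *: _]mulr1.
exact: fD.
Qed.

(** * Equivalence of an arbitrary norm with the sup norm *)

Section NormFacts.
Context (R : realType) (n : nat) (N : 'cV[R]_n -> R) (hN : is_norm N).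
Implicit Types (u v : 'cV[R]_n) (A : 'M[R]_n).

Lemma is_norm0 : N 0 = 0.
Proof. by rewrite -(scale0r 0) is_normZ// normr0 mul0r. Qed.

Lemma is_normN v : N (- v) = N v.
Proof. by rewrite -scaleN1r is_normZ// normrN normr1 mul1r. Qed.

Lemma is_norm_distC u v : N (u - v) = N (v - u).
Proof. by rewrite -is_normN opprB. Qed.

Lemma is_norm_sum (I : Type) (s : seq I) (f : I -> 'cV[R]_n) :
  N (\sum_(i <- s) f i) <= \sum_(i <- s) N (f i).
Proof.
elim/big_rec2: _ => [|i y1 y2 _ le12]; first by rewrite is_norm0.
by rewrite (le_trans (is_normD hN _ _))// lerD2l.
Qed.

Lemma is_norm_le_mx_norm : exists2 C : R, 0 < C & forall v, N v <= C * `|v|.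
Proof.
(* The bound comes from expanding [v] in the canonical basis; the summand 1 keeps the constant
   positive even when [n] is 0. *)
exists (1 + \sum_i N (delta_mx i 0)).
  by rewrite ltr_pwDl// sumr_ge0// => i _; exact: is_norm_ge0.
move=> v; rewrite {1}[v]matrix_sum_delta.
under eq_bigr do rewrite big_ord1.
rewrite (le_trans (is_norm_sum _ _))// mulrDl mul1r mulr_suml.
apply: ler_wpDl; first exact: normr_ge0.
apply: ler_sum => i _.
by rewrite is_normZ// mulrC ler_wpM2l ?is_norm_ge0 ?le_abs_mx_norm.
Qed.

Lemma is_norm_dist u v : `|N u - N v| <= N (u - v).
Proof.
have tri a b : N a - N b <= N (a - b).
  by rewrite lerBlDr (le_trans _ (is_normD hN _ _))// subrK.
by rewrite ler_norml tri andbT lerNl opprB is_norm_distC tri.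
Qed.

Lemma is_norm_continuous : continuous N.
Proof.
have [C C0 NC] := is_norm_le_mx_norm.
move=> v; apply/(@cvgrPdist_le _ _ _ (nbhs v)) => e e0; near=> w.
rewrite (le_trans (is_norm_dist _ _))// (le_trans (NC _))//.
rewrite -ler_pdivlMl// mulrC.
by near: w; apply: (@cvgr_dist_le _ _ _ (nbhs v) _ id v) => //; exact: divr_gt0.
Unshelve. all: by end_near. Qed.

(** By compactness [N] attains its minimum on the sup-norm unit sphere. The minimum is positive
    because 0 is not on the sphere; its inverse is the constant, by homogeneity. *)
Lemma mx_norm_le_is_norm : exists2 C : R, 0 < C & forall v, `|v| <= C * N v.
Proof.
(* The sphere consists of row vectors, the form to which [EVT_min_rV] applies; transposition
   preserves the sup norm. *)
pose sphere := [set v : 'rV[R]_n | `|v| = 1].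
have scaled (v : 'cV[R]_n) : v <> 0 -> sphere (`|v|^-1 *: v^T).
  move=> /eqP v0; rewrite /sphere/= normrZ mx_norm_tr normfV normr_id mulVf//.
  by rewrite normr_eq0.
(* If the sphere is empty, every vector is 0 and any constant works. *)
have [sph0|/set0P sphN0] := eqVneq sphere set0.
  exists 1 => // v; have [->|/eqP/scaled] := eqVneq v 0.
    by rewrite normr0 mul1r is_norm_ge0.
  by rewrite sph0.
have csph : compact sphere.
  apply: bounded_closed_compact.
    by exists 1; split=> // e e1 v/= ->; exact: ltW.
  rewrite (_ : sphere = Num.norm @^-1` [set 1 : R])//.
  apply: closed_comp; last exact: closed_eq.
  by move=> v _; exact: norm_continuous.
have ctr : continuous (@trmx R 1 n).
  move=> v; apply/(@cvgrPdist_le _ _ _ (nbhs v)) => e e0; near=> w.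
  rewrite -linearB mx_norm_tr.
  by near: w; exact: (@cvgr_dist_le _ _ _ (nbhs v) _ id v).
have [|c] := EVT_min_rV (f := N \o trmx) sphN0 csph.
  apply: continuous_subspaceT => v; apply: continuous_comp; first exact: ctr.
  exact: is_norm_continuous.
rewrite inE => c1 /= cmin.
have Nc : 0 < N c^T.
  rewrite lt_neqAle is_norm_ge0// andbT eq_sym.
  apply/eqP => /(is_norm_eq0 hN)/(congr1 trmx).
  rewrite trmxK trmx0 => c0.
  by move: c1; rewrite /sphere/= c0 normr0 => /eqP; rewrite eq_sym oner_eq0.
exists (N c^T)^-1; first by rewrite invr_gt0.
move=> v; rewrite ler_pdivlMl//.
have [->|/eqP v0] := eqVneq v 0; first by rewrite normr0 mulr0 is_norm_ge0.
have := cmin (`|v|^-1 *: v^T); rewrite inE => /(_ (scaled _ v0)).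
rewrite linearZ/= trmxK is_normZ// normfV normr_id.
have Nv0 : 0 < `|v| by rewrite normr_gt0; apply/eqP.
by rewrite (ler_pdivlMl _ _ Nv0) mulrC.
Unshelve. all: by end_near. Qed.

(** * Operators, operator norm and mean value inequality *)

Lemma is_norm_comp A : A \in unitmx -> is_norm (fun v => N (A *m v)).
Proof.
move=> uA; split=> [v|v|a v|u v].
- exact: is_norm_ge0.
- by move/(is_norm_eq0 hN)/(congr1 (mulmx (invmx A))); rewrite mulKmx// mulmx0.
- by rewrite -scalemxAr is_normZ.
- by rewrite mulmxDr is_normD.
Qed.

(** This makes the set in [opnorm] bounded above, so that its [sup] is a genuine upper bound and not
    a default value. *)
Lemma mulmx_is_norm_bounded A :
  exists2 C : R, 0 <= C & forall v, N (A *m v) <= C * N v.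
Proof.
have [C C0 NC] := is_norm_le_mx_norm.
have [D D0 ND] := mx_norm_le_is_norm.
exists ((\sum_i N (col i A)) * D).
  by rewrite mulr_ge0 ?(ltW D0)// sumr_ge0// => i _; exact: is_norm_ge0.
move=> v; rewrite -mulrA.
have -> : A *m v = \sum_i v i 0 *: col i A.
  apply/colP => i; rewrite mxE summxE; apply: eq_bigr => j _.
  by rewrite !mxE mulrC.
rewrite (le_trans (is_norm_sum _ _))// mulr_suml; apply: ler_sum => i _.
rewrite is_normZ// mulrC ler_wpM2l ?is_norm_ge0//.
by rewrite (le_trans (le_abs_mx_norm _ _ _)).
Qed.

Lemma opnorm_ge A v : N v <= 1 -> N (A *m v) <= opnorm N A.
Proof.
move=> v1; have [C C0 AC] := mulmx_is_norm_bounded A.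
apply: ub_le_sup; last by exists v.
exists C => _ [w /= w1 <-]; rewrite (le_trans (AC _))//.
by rewrite -[leRHS]mulr1 ler_wpM2l.
Qed.

Lemma opnorm_ge0 A : 0 <= opnorm N A.
Proof.
by have := @opnorm_ge A 0; rewrite mulmx0 is_norm0; apply; exact: ler01.
Qed.

Lemma opnormP A v : N (A *m v) <= opnorm N A * N v.
Proof.
have [/(is_norm_eq0 hN)->|v0] := eqVneq (N v) 0.
  by rewrite mulmx0 is_norm0 mulr0.
have Nv0 : 0 < N v by rewrite lt_neqAle eq_sym v0 is_norm_ge0.
have normalize w : N ((N v)^-1 *: w) = N w / N v.
  by rewrite is_normZ// normfV ger0_norm ?is_norm_ge0// mulrC.
by rewrite -ler_pdivrMr// -normalize scalemxAr opnorm_ge// normalize divff.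
Qed.

Lemma mulmx_norm_le A v a : opnorm N A <= a -> N (A *m v) <= a * N v.
Proof.
by move=> Aa; rewrite (le_trans (opnormP _ _))// ler_wpM2r// is_norm_ge0.
Qed.

(* At a point c > a, the two derivatives give g s > g c for s slightly left of c,
   so the maximum of g over [a, b] is attained at a. *)
Lemma mean_value_le (phi dphi : R -> 'cV[R]_n) (h dh : R -> R) (a b : R) :
  a <= b ->
  (forall t, t \in `[a, b] -> is_derive t 1 phi (dphi t)) ->
  (forall t, t \in `[a, b] -> is_derive t 1 h (dh t)) ->
  (forall t, t \in `[a, b] -> N (dphi t) <= dh t) ->
  N (phi b - phi a) <= h b - h a.
Proof.
move=> ab dphiP dhP le_dphi.
(* The extra slope [e] makes the comparison at the maximum strict. It is removed at the end by
   taking [e / (b - a + 1)], whose denominator is positive even when [a = b]. *)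
suff le_slope e : 0 < e -> N (phi b - phi a) <= h b - h a + e * (b - a).
  apply/ler_addgt0Pr => e e0.
  have ba0 : 0 < b - a + 1 by rewrite ltr_wpDl ?subr_ge0.
  rewrite (le_trans (le_slope (e / (b - a + 1)) _)) ?divr_gt0// lerD2l.
  by rewrite mulrAC ler_pdivrMr// ler_pM2l// lerDl.
move=> e0; pose g t := N (phi t - phi a) - h t - e * t.
have phi_cont t : t \in `[a, b] -> {for t, continuous phi}.
  by move=> /dphiP[+ _] => /derivable1_diffP/differentiable_continuous.
have h_cont t : t \in `[a, b] -> {for t, continuous h}.
  by move=> /dhP[+ _] => /derivable1_diffP/differentiable_continuous.
have [|c cab gmax] := @EVT_max _ g a b ab.
  apply: continuous_in_subspaceT => t; rewrite inE/= => tab.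
  apply: cvgB; last by apply: cvgM; [exact: cvg_cst|exact: cvg_id].
  apply: cvgB; last exact: h_cont.
  apply: (@continuous_comp _ _ _ (fun s => phi s - phi a) N).
    by apply: cvgB; [exact: phi_cont|exact: cvg_cst].
  exact: is_norm_continuous.
have [ca|ca] := eqVneq c a.
  have := gmax b; rewrite in_itv/= lexx ab => /(_ isT).
  by rewrite /g ca subrr is_norm0; lra.
have {ca} ac : a < c.
  by rewrite lt_neqAle eq_sym ca; move: cab; rewrite in_itv/= => /andP[].
exfalso.
have Nq : N (s^-1 *: (phi (s + c) - phi c)) @[s --> 0^'-] --> N (dphi c).
  apply: cvg_comp; first exact: is_derive_cvg_at_left (dphiP _ cab).
  exact: is_norm_continuous.
have hq := is_derive_cvg_at_left (dhP _ cab).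
(* Each of the two difference quotients may err by [e / 2]; together the errors use up exactly the
   slope [e] in [g]. *)
have e20 : 0 < e / 2 by rewrite divr_gt0.
have [s [s0 acs phiq_lt hq_gt]] : exists s : R,
    [/\ s < 0, a - c <= s,
      N (s^-1 *: (phi (s + c) - phi c)) < N (dphi c) + e / 2 &
      dh c - e / 2 < s^-1 * (h (s + c) - h c)].
  near (0 : R)^'- => s; exists s; split; near: s.
  - exact: nbhs_left_lt.
  - by apply: nbhs_left_ge; rewrite subr_lt0.
  - by apply: (cvgr_lt (N (dphi c))) => //; rewrite ltrDl.
  - by apply: (cvgr_gt (dh c)) => //; rewrite gtrBl.
have := gmax (s + c); rewrite in_itv/=.
have -> /= : a <= s + c <= b.
  by move: cab; rewrite in_itv/= => /andP[_ cb]; apply/andP; split; lra.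
move=> /(_ isT); apply/negP; rewrite -ltNge /g.
have : N (phi c - phi a) <= N (phi (s + c) - phi a) + N (phi (s + c) - phi c).
  rewrite (is_norm_distC (phi (s + c)) (phi c)) (le_trans _ (is_normD hN _ _))//.
  by rewrite [X in _ <= N X]addrC subrKA.
have sN : 0 < - s by rewrite oppr_gt0.
move: phiq_lt hq_gt; rewrite is_normZ// normfV ltr0_norm// .
rewrite (ltr_pdivrMl _ _ sN) => phi_lt.
rewrite -(ltr_nM2l s0) mulVKf ?lt_eqF// => h_lt.
have : - s * N (dphi c) <= - s * dh c by rewrite ler_pM2l// le_dphi.
by move: phi_lt h_lt; lra.
Unshelve. all: by end_near. Qed.

End NormFacts.

(** A point at distance below the supremum is at distance below some admissible radius [t], so no
    case distinction on an infinite radius arises. *)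
Lemma nball_inner_radius (R : realType) (n : nat) (N : 'cV[R]_n -> R)
    (Omega : set 'cV[R]_n) (a : 'cV[R]_n) :
  nball N a (inner_radius N Omega a) `<=` Omega.
Proof.
move=> x; rewrite /nball/= /inner_radius => /ereal_sup_gt[_ [t [_ tO] <-] xt].
exact: tO.
Qed.

Lemma unitmx_inj (K : fieldType) (n : nat) (A : 'M[K]_n) :
  (forall v : 'cV[K]_n, A *m v = 0 -> v = 0) -> A \in unitmx.
Proof.
move=> injA; rewrite -unitmx_tr -row_free_unit; apply: inj_row_free => v vA.
by apply: trmx_inj; rewrite trmx0; apply: injA; rewrite -[A]trmxK -trmx_mul vA trmx0.
Qed.

(** * Estimates for a single step *)

Section Newton.
Context (R : realType) (n : nat) (N : 'cV[R]_n -> R) (hN : is_norm N).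
Implicit Types (u v w x y : 'cV[R]_n) (A B : 'M[R]_n).

(** The difference quotient of [F] along the line is the directional difference quotient of [F] at
    [x + t *: v]. *)
Lemma is_derive_line (F : 'cV[R]_n -> 'cV[R]_n) x v (t : R) :
  differentiable F (x + t *: v) ->
  is_derive t 1 (fun s => F (x + s *: v)) (derivmx F (x + t *: v) *m v).
Proof.
move=> dF.
have quotE : (fun h : R => h^-1 *: (F (x + (h *: (1 : R) + t) *: v) - F (x + t *: v)))
    = (fun h : R => h^-1 *: (F (h *: v + (x + t *: v)) - F (x + t *: v))).
  by apply/funext => h; rewrite [h *: _]mulr1 scalerDl addrCA.
have dFv : is_derive (x + t *: v) v F (derivmx F (x + t *: v) *m v).
  by apply: DeriveDef; [exact: diff_derivable|rewrite deriveE// derivmxE].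
case: dFv => dFv <-.
by apply: DeriveDef; rewrite /derivable /derive /= quotE.
Qed.

(** The mean value inequality is applied in the norm [N (A *m _)] to F(x + tv) - tF'(x)v, with M t^2
    / 2 as the dominating function; the factor 1/2 comes from there. *)
Lemma taylor_remainder_le (F : 'cV[R]_n -> 'cV[R]_n) A x v (M : R) :
  A \in unitmx ->
  (forall t : R, 0 <= t <= 1 -> differentiable F (x + t *: v)) ->
  (forall t : R, 0 <= t <= 1 ->
     N (A *m ((derivmx F (x + t *: v) - derivmx F x) *m v)) <= M * t) ->
  N (A *m (F (x + v) - F x - derivmx F x *m v)) <= M / 2.
Proof.
move=> uA dF le_dF; pose c := derivmx F x *m v.
pose phi (t : R) := F (x + t *: v) - t *: c.
pose h (t : R) := M / 2 * t ^+ 2.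
have -> : F (x + v) - F x - c = phi 1 - phi 0.
  by rewrite /phi !scale1r !scale0r addr0 subr0 addrAC.
have -> : M / 2 = h 1 - h 0 by rewrite /h expr1n expr0n mulr1 mulr0 subr0.
apply: (@mean_value_le _ _ (fun u => N (A *m u)) (is_norm_comp hN uA) phi
  (fun t => derivmx F (x + t *: v) *m v - c) h (fun t => M * t)) => // t.
- rewrite in_itv/= => t01; apply: is_deriveB; first exact/is_derive_line/dF.
  have dscale : differentiable (fun s : R => s *: c) t by exact: ex_diff.
  apply: DeriveDef; first exact: diff_derivable.
  by rewrite deriveE// diff_val scale1r.
- move=> _; apply: is_derive_eq; rewrite -[LHS]/(M / 2 * (t * 1 + t * 1)); lra.
- by rewrite in_itv/= => t01; rewrite -mulmxBl le_dF.
Qed.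

(** Banach's lemma: u = A^-1 B u - A^-1 (B - A) u gives (1 - q) N(u) <= N(A^-1 B u). Hence [B] is
    injective, so invertible, and u = B^-1 w gives the bound. *)
Lemma perturbation A B (q : R) : A \in unitmx -> q < 1 ->
  opnorm N (invmx A *m (B - A)) <= q ->
  B \in unitmx /\
  forall w, N (invmx B *m w) <= N (invmx A *m w) / (1 - q).
Proof.
move=> uA q1 le_q.
have q10 : 0 < 1 - q by rewrite subr_gt0.
have le_B u : N u <= N (invmx A *m (B *m u)) / (1 - q).
  rewrite ler_pdivlMr//.
  have : N u <= N (invmx A *m (B *m u)) + N (invmx A *m (B - A) *m u).
    rewrite -[X in _ + X](is_normN hN) -[leLHS]/(N u).
    rewrite (le_trans _ (is_normD hN _ _))// mulmxBr mulVmx// mulmxBl mul1mx.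
    by rewrite mulmxA opprB addrC subrK.
  have := mulmx_norm_le hN u le_q; lra.
have uB : B \in unitmx.
  apply: unitmx_inj => u Bu; apply/(is_norm_eq0 hN)/eqP.
  rewrite eq_le is_norm_ge0// andbT (le_trans (le_B u))//.
  by rewrite Bu mulmx0 (is_norm0 hN)// mul0r.
split=> // w; have := le_B (invmx B *m w).
by rewrite mulKVmx.
Qed.
(** J^-1 r = (PJ)^-1 (P r) costs the norm of (PJ)^-1, and P f = (PJ)(J^-1 f) costs the norm of PJ;
    their product is the condition number. *)
Lemma residual_le (P J : 'M[R]_n) (theta vartheta : R) r f :
  P \in unitmx -> J \in unitmx -> 0 <= theta ->
  N (P *m r) <= theta * N (P *m f) ->
  theta * cond N (P *m J) <= vartheta ->
  N (invmx J *m r) <= vartheta * N (invmx J *m f).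
Proof.
move=> uP uJ theta0 le_r le_cond.
have uPJ : P *m J \in unitmx by rewrite unitmx_mul uP.
have -> : invmx J *m r = invmx (P *m J) *m (P *m r).
  have -> : r = J *m (invmx J *m r) by rewrite mulKVmx.
  by rewrite mulKmx// !mulmxA -[_ *m P *m J]mulmxA mulVmx// mul1mx.
rewrite (le_trans (opnormP hN _ _))//.
have le_f : N (P *m f) <= opnorm N (P *m J) * N (invmx J *m f).
  have -> : P *m f = P *m J *m (invmx J *m f) by rewrite -mulmxA mulKVmx.
  exact: opnormP.
rewrite (le_trans (ler_wpM2l (opnorm_ge0 hN _) le_r))//.
rewrite (le_trans (ler_wpM2l (opnorm_ge0 hN _) (ler_wpM2l theta0 le_f)))//.
rewrite (le_trans _ (ler_wpM2r (is_norm_ge0 hN _) le_cond))//.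
by rewrite /cond le_eqVlt; apply/orP; left; apply/eqP; ring.
Qed.

(** Here [d] stands for the current error, so that [d + S] is the next one, and [f] for the value of
    F. *)
Lemma inexact_step_le (B J : 'M[R]_n) (omega1 omega2 vartheta : R) d S f r :
  B \in unitmx -> J \in unitmx ->
  opnorm N (invmx B *m J) <= omega1 ->
  opnorm N (invmx B *m J - 1%:M) <= omega2 ->
  0 <= vartheta -> N (invmx J *m r) <= vartheta * N (invmx J *m f) ->
  B *m S = - f + r ->
  N (d + S) <= omega1 * (1 + vartheta) * N (invmx J *m (f - J *m d))
             + (omega1 * vartheta + omega2) * N d.
Proof.
move=> uB uJ le1 le2 vartheta0 le_r BS.
have omega10 : 0 <= omega1 by rewrite (le_trans _ le1)// opnorm_ge0.
pose rho := invmx J *m (f - J *m d).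
have fE : invmx J *m f = d + rho by rewrite /rho mulmxBr mulKmx// addrC subrK.
have -> : d + S = - ((invmx B *m J - 1%:M) *m d) + - (invmx B *m J *m rho)
                  + invmx B *m J *m (invmx J *m r).
  have -> : rho = invmx J *m f - d by rewrite fE addrC addKr.
  have -> : S = invmx B *m (- f + r) by rewrite -BS mulKmx.
  rewrite mulmxBl mul1mx [_ *m J *m (_ - _)]mulmxBr -!(mulmxA (invmx B)) !mulKVmx//.
  rewrite mulmxDr mulmxN !opprB addrA; congr (_ + _).
  by rewrite addrA subrK.
have le_d := mulmx_norm_le hN d le2.
have le_rho := mulmx_norm_le hN rho le1.
have le_Jr := mulmx_norm_le hN (invmx J *m r) le1.
have le_f : N (invmx J *m f) <= N d + N rho by rewrite fE is_normD.
have le_wr := ler_wpM2l omega10 le_r.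
have le_wf := ler_wpM2l omega10 (ler_wpM2l vartheta0 le_f).
rewrite (le_trans (is_normD hN _ _))//.
have := is_normD hN (- ((invmx B *m J - 1%:M) *m d)) (- (invmx B *m J *m rho)).
rewrite !(is_normN hN)// -/rho; lra.
Qed.

End Newton.

(** * The Newton remainder near the root *)

Section LocalConvergence.
Context (R : realType) (n : nat) (N : 'cV[R]_n -> R) (hN : is_norm N).
Context (F : 'cV[R]_n -> 'cV[R]_n) (xs : 'cV[R]_n) (kappa : \bar R) (K : R).
Hypotheses (uF : derivmx F xs \in unitmx) (Fxs : F xs = 0) (K0 : 0 < K).
Hypothesis dF : forall x, nball N xs kappa x -> differentiable F x.
Hypothesis lipF : forall x y, nball N xs kappa x -> nball N xs kappa y ->
  opnorm N (invmx (derivmx F xs) *m (derivmx F x - derivmx F y))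
    <= K * N (x - y).

Lemma newton_remainder_le x : nball N xs kappa x -> K * N (x - xs) < 1 ->
  derivmx F x \in unitmx /\
  N (invmx (derivmx F x) *m (F x - derivmx F x *m (x - xs)))
    <= K * N (x - xs) / (2 * (1 - K * N (x - xs))) * N (x - xs).
Proof.
set e := N (x - xs) => kx Ke1.
have kxs : nball N xs kappa xs.
  rewrite /nball/= subrr (is_norm0 hN); apply: le_lt_trans kx.
  by rewrite lee_fin (is_norm_ge0 hN).
(* The expansion is based at [x] and directed to [xs], so that its linear part is F'(x); with F(xs)
   = 0 its remainder is the Newton remainder up to sign. *)
pose v := xs - x.
have Nv : N v = e by rewrite (is_norm_distC hN).
have kseg t : 0 <= t <= 1 -> nball N xs kappa (x + t *: v).
  move=> /andP[t0 t1]; apply: le_lt_trans kx; rewrite lee_fin.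
  have -> : x + t *: v - xs = (1 - t) *: (x - xs).
    by rewrite /v scalerBl scale1r -scalerN opprB addrAC.
  by rewrite (is_normZ hN) ger0_norm ?subr_ge0// ler_piMl ?(is_norm_ge0 hN)// gerBl.
(* One factor [e] comes from the Lipschitz bound, whose points are [t * e] apart, the other from
   [v]. *)
have lip_seg t : 0 <= t <= 1 ->
    N (invmx (derivmx F xs) *m ((derivmx F (x + t *: v) - derivmx F x) *m v))
      <= K * e * e * t.
  move=> t01; have /andP[t0 _] := t01.
  rewrite mulmxA (le_trans (mulmx_norm_le hN v (lipF (kseg _ t01) kx)))//.
  rewrite addrAC subrr add0r (is_normZ hN) ger0_norm// Nv.
  by rewrite le_eqVlt; apply/orP; left; apply/eqP; ring.
have uFV : invmx (derivmx F xs) \in unitmx by rewrite unitmx_inv; exact: uF.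
have le_taylor := taylor_remainder_le hN uFV (fun t t01 => dF (kseg t t01)) lip_seg.
have [uJ le_J] := perturbation hN uF Ke1 (lipF kx kxs).
split; [exact: uJ|apply: le_trans (le_J _) _]; clear uFV uJ le_J.
have Ke0 : 0 < 1 - K * e by rewrite subr_gt0.
have -> : F x - derivmx F x *m (x - xs) = - (F (x + v) - F x - derivmx F x *m v).
  rewrite /v addrCA subrr addr0 Fxs sub0r -(opprB x xs) mulmxN opprK.
  by rewrite opprD opprK.
rewrite mulmxN (is_normN hN) (ler_pdivrMr _ _ Ke0) (le_trans le_taylor)//.
rewrite le_eqVlt; apply/orP; left; apply/eqP; field.
exact: lt0r_neq0.
Qed.

End LocalConvergence.

(** * The contraction factor and the radius *)

Section Radius.
Context (R : realType) (K vartheta omega1 omega2 : R).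
Hypotheses (K0 : 0 < K) (vartheta0 : 0 <= vartheta) (vartheta1 : vartheta < 1)
  (omega20 : 0 <= omega2) (omega21 : omega2 < omega1)
  (homega : omega1 * vartheta + omega2 < 1).

(** A function of the error, since a step yields it at the current error and the theorem states it
    at the initial one. *)
Definition contraction_factor (e : R) :=
  omega1 * (1 + vartheta) * ((K * e) / (2 * (1 - K * e)))
  + omega1 * vartheta + omega2.

Lemma contraction_factor_ge0 e : 0 <= e -> K * e < 1 ->
  0 <= contraction_factor e.
Proof.
move=> e0 Ke1; have omega10 : 0 <= omega1 by rewrite ltW// (le_lt_trans omega20).
have den0 : 0 < 2 * (1 - K * e) by lra.
apply: addr_ge0 => //; apply: addr_ge0; last exact: mulr_ge0.
apply: mulr_ge0; first by rewrite mulr_ge0// addr_ge0.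
by apply: divr_ge0; [rewrite mulr_ge0// ltW|exact: ltW].
Qed.

Lemma contraction_factor_le e e' : 0 <= e -> e <= e' -> K * e' < 1 ->
  contraction_factor e <= contraction_factor e'.
Proof.
move=> e0 ee' Ke1; have omega10 : 0 <= omega1 by rewrite ltW// (le_lt_trans omega20).
have KeK : K * e <= K * e' by rewrite ler_pM2l.
have den0 : 0 < 2 * (1 - K * e) by lra.
have den0' : 0 < 2 * (1 - K * e') by lra.
rewrite !lerD2r ler_wpM2l ?mulr_ge0 ?addr_ge0// ler_pM//.
- by rewrite mulr_ge0// ltW.
- by rewrite invr_ge0 ltW.
- by rewrite lef_pV2//; lra.
Qed.

(** Clearing denominators in [contraction_factor e < 1] and collecting the terms in K e gives
    exactly the hypothesis. The bound on [K * e] holds because the denominator without K exceeds the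
    numerator by omega1 (1 + vartheta). *)
Lemma radius_lt e :
  e < 2 * (1 - vartheta * omega1 - omega2) /
        (K * (2 + omega1 - vartheta * omega1 - 2 * omega2)) ->
  K * e < 1 /\ contraction_factor e < 1.
Proof.
have omega10 : 0 < omega1 by rewrite (le_lt_trans omega20).
have w0 : 0 < omega1 * (1 - vartheta) by rewrite mulr_gt0// subr_gt0.
have w1 : 0 <= omega1 * vartheta by rewrite mulr_ge0// ltW.
have den0 : 0 < 2 + omega1 - vartheta * omega1 - 2 * omega2 by move: homega; lra.
rewrite ltr_pdivlMr ?mulr_gt0// mulrA => e_lt.
have Ke1 : K * e < 1.
  rewrite -(ltr_pM2r den0) mul1r (mulrC K) (lt_le_trans e_lt)//.
  by move: w0; lra.
split=> //; rewrite /contraction_factor.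
have Ke0 : 0 < 2 * (1 - K * e) by rewrite mulr_gt0// subr_gt0.
rewrite -addrA -ltrBrDr mulrA ltr_pdivrMr//; lra.
Qed.
End Radius.

(** * Induction along the iterates and convergence *)

Theorem theorem14 (R : realType) (n : nat) (N : 'cV[R]_n -> R)
    (hN : is_norm N)
    (Omega : set 'cV[R]_n) (hOmega : open Omega)
    (F : 'cV[R]_n -> 'cV[R]_n) (hF : C1_on Omega F)
    (xs : 'cV[R]_n) (hxs : Omega xs)
    (hF'xs : derivmx F xs \in unitmx) (hFxs : F xs = 0)
    (K : R) (hK : 0 < K)
    (hLip : forall x y : 'cV[R]_n,
       nball N xs (inner_radius N Omega xs) x ->
       nball N xs (inner_radius N Omega xs) y ->
       opnorm N (invmx (derivmx F xs) *m (derivmx F x - derivmx F y))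
         <= K * N (x - y))
    (vartheta omega1 omega2 : R)
    (hvartheta0 : 0 <= vartheta) (hvartheta1 : vartheta < 1)
    (homega2 : 0 <= omega2) (homega21 : omega2 < omega1)
    (homega : omega1 * vartheta + omega2 < 1) :
  let kappa : \bar R := inner_radius N Omega xs in
  let sigma : \bar R :=
    Order.min kappa
      ((2 * (1 - vartheta * omega1 - omega2) /
        (K * (2 + omega1 - vartheta * omega1 - 2 * omega2)))%:E) in
  forall (B : 'cV[R]_n -> 'M[R]_n) (x S r : nat -> 'cV[R]_n)
         (P : nat -> 'M[R]_n) (theta : nat -> R),
  let step := inexact_newton_like_step N F B vartheta omega1 omega2
                x S r P theta in
  nball N xs sigma (x 0%N) -> x 0%N <> xs ->
  (* well-definedness: whenever the first m steps have been performed, the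
     conditions defining the next one make sense *)
  (forall m : nat, (forall k : nat, (k < m)%N -> step k) ->
     Omega (x m) /\ derivmx F (x m) \in unitmx) /\
  ((forall k : nat, step k) ->
     [/\ forall k : nat, nball N xs sigma (x k),
         x @ \oo --> xs &
         forall k : nat,
           N (x k.+1 - xs) <=
             (omega1 * (1 + vartheta) *
                ((K * N (x 0%N - xs)) / (2 * (1 - K * N (x 0%N - xs))))
              + omega1 * vartheta + omega2) * N (x k - xs)]).
Proof.
move=> kappa sigma B x S r P theta step x0_sigma _.
pose e0 := N (x 0%N - xs); pose c := contraction_factor K vartheta omega1 omega2 e0.
have e00 : 0 <= e0 by exact: is_norm_ge0.
move: (x0_sigma); rewrite /nball/= lt_min lte_fin => /andP[x0_kappa].
move=> /(radius_lt hK hvartheta0 hvartheta1 homega2 homega21 homega)[Ke0 c1].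
have c0 : 0 <= c.
  exact: (contraction_factor_ge0 hK hvartheta0 homega2 homega21 e00 Ke0).
have dF y : nball N xs kappa y -> differentiable F y.
  by move=> /nball_inner_radius; exact: hF.1.
have kappaP y : N (y - xs) <= e0 -> nball N xs kappa y.
  by move=> ye0; apply: le_lt_trans x0_kappa; rewrite lee_fin.
have Ke1 y : N (y - xs) <= e0 -> K * N (y - xs) < 1.
  by move=> ye0; apply: le_lt_trans Ke0; rewrite ler_pM2l.
have remainder y (ye0 : N (y - xs) <= e0) :=
  newton_remainder_le hN hF'xs hFxs dF hLip (kappaP _ ye0) (Ke1 _ ye0).
(* If [hF'xs] stays in context, [//] compares it by conversion with the goals
   below and unfolds determinants. *)
clear hF'xs.
(* The step contracts by the factor at the current error; monotonicity replaces it by the fixed [c],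
   the factor at the initial error. *)
have contract k : N (x k - xs) <= e0 -> step k ->
    N (x k.+1 - xs) <= c * N (x k - xs).
  move=> ke0 [-> BS [uB le1 le2] [uP theta0 le_r le_cond]].
  have [uJ le_rho] := remainder _ ke0.
  have le_Jr := residual_le hN uP uJ theta0 le_r le_cond.
  have le_step := inexact_step_le hN (x k - xs) uB uJ le1 le2 hvartheta0 le_Jr BS.
  clear uB uP uJ; rewrite addrAC (le_trans le_step)//.
  have w0 : 0 <= omega1 * (1 + vartheta).
    by rewrite mulr_ge0 ?addr_ge0// ltW// (le_lt_trans homega2).
  apply: (@le_trans _ _ (contraction_factor K vartheta omega1 omega2 (N (x k - xs))
      * N (x k - xs))).
    by have := ler_wpM2l w0 le_rho; rewrite /contraction_factor; lra.
  rewrite ler_wpM2r ?(is_norm_ge0 hN)//.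
  exact: (contraction_factor_le hK hvartheta0 homega2 homega21 (is_norm_ge0 hN _) ke0 Ke0).
(* Only the steps before [m] are assumed, so the bound serves both well-definedness of a partial run
   and convergence of a full one. *)
have bounded m : (forall k, (k < m)%N -> step k) -> N (x m - xs) <= c ^+ m * e0.
  elim: m => [|m IH] steps; first by rewrite expr0 mul1r.
  have le_m := IH (fun k km => steps k (ltnW km)).
  have me0 : N (x m - xs) <= e0.
    by rewrite (le_trans le_m)// ler_piMl// exprn_ile1// ltW.
  by rewrite (le_trans (contract _ me0 (steps _ _)))// exprS -mulrA ler_wpM2l.
have bounded0 m : (forall k, (k < m)%N -> step k) -> N (x m - xs) <= e0.
  move=> /bounded/le_trans; apply.
  by rewrite ler_piMl// exprn_ile1// ltW.
split=> [m /bounded0 me0|steps].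
  by split; [exact: nball_inner_radius (kappaP _ me0)|exact: (remainder _ me0).1].
split=> [k||k].
- by apply: le_lt_trans x0_sigma; rewrite lee_fin; exact: bounded0.
(* Convergence is in the sup norm, so the geometric bound in [N] is transferred by norm
   equivalence. *)
- have [C C0 NC] := mx_norm_le_is_norm hN.
  apply/(@cvgrPdist_le _ _ _ \oo) => e e_gt0.
  have : (fun m => C * (c ^+ m * e0)) @ \oo --> (0 : R).
    rewrite -[X in _ --> X](mulr0 C) -(mul0r e0).
    apply: cvgMr; apply: cvgMl; apply: cvg_expr.
    by rewrite ger0_norm.
  move=> /cvgrPdist_le/(_ _ e_gt0); apply: filterS => m.
  rewrite sub0r normrN => le_e.
  rewrite distrC (le_trans (NC _))// (le_trans _ le_e)//.
  by rewrite (le_trans _ (ler_norm _))// ler_pM2l// bounded.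
- by apply: contract => //; exact: bounded0.
Qed.
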